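(* Let $\lambda, x \in \mathbb{C}$. For every integer $n \ge 0$, $$\beta_n(x\mid\lambda)=\sum_{l=0}^{n}\binom{n}{l}\beta_l(\lambda)\,(x\mid\lambda)_{n-l},$$ $$(x\mid\lambda)_n=\sum_{l=0}^{n}\frac{(1\mid\lambda)_{l+1}}{l+1}\binom{n}{l}\beta_{n-l}(x\mid\lambda),$$ and $$\beta_0(\lambda)=1,\qquad \beta_n(1\mid\lambda)-\beta_n(\lambda)=\delta_{1,n}.$$
   Context: For $\lambda,x\in\mathbb{C}$ and an integer $n\ge 0$, put $(x\mid\lambda)_n = x(x-\lambda)(x-2\lambda)\cdots(x-(n-1)\lambda)$, with $(x\mid\lambda)_0=1$. As a formal power series in $t$, $(1+\lambda t)^{x/\lambda}=\sum_{n\ge0}(x\mid\lambda)_n\frac{t^n}{n!}$ (for $\lambda=0$ this is read as the limit $e^{xt}$). The Carlitz degenerate Bernoulli polynomials $\beta_n(x\mid\lambda)$ are defined by $$\frac{t}{(1+\lambda t)^{1/\lambda}-1}(1+\lambda t)^{x/\lambda}=\sum_{n=0}^{\infty}\beta_n(x\mid\lambda)\frac{t^n}{n!},$$ and the degenerate Bernoulli numbers are $\beta_n(\lambda)=\beta_n(0\mid\lambda)$. $\delta_{k,n}$ is the Kronecker symbol. *)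

(* Defs.v *)
From mathcomp Require Import all_boot all_order all_algebra.
From mathcomp Require Import reals.
From mathcomp.real_closed Require Import complex.

Set Implicit Arguments.
Unset Strict Implicit.
Unset Printing Implicit Defensive.

Import GRing.Theory.
Local Open Scope ring_scope.

(* A formal power series is represented by its coefficient sequence. *)
Definition fps (K : Type) : Type := nat -> K.

Section FormalPowerSeries.
Variable K : fieldType.
Implicit Types f g : fps K.

Definition fps1 : fps K := fun n => (n == 0)%:R.

Definition fpsX : fps K := fun n => (n == 1)%:R.

Definition fps_sub f g : fps K := fun n => f n - g n.

Definition fps_mul f g : fps K :=
  fun n => \sum_(i < n.+1) f i * g (n - i)%N.

(* The first n coefficients of 1 / f, from the recurrence
   f_0 h_m = [m = 0] - \sum_(i < m) f_(m - i) h_i. *)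
Fixpoint fps_inv_seq f (n : nat) : seq K :=
  if n is m.+1 then
    let h := fps_inv_seq f m in
    rcons h ((f 0)^-1 * ((m == 0)%:R - \sum_(i < m) f (m - i)%N * h`_i))
  else [::].

(* Meaningful only when f 0 != 0. *)
Definition fps_inv f : fps K := fun n => (fps_inv_seq f n.+1)`_n.

(* (f - f_0) / t *)
Definition fps_divX f : fps K := fun n => f n.+1.

Lemma size_fps_inv_seq f n : size (fps_inv_seq f n) = n.
Proof. by elim: n => //= n IHn; rewrite size_rcons IHn. Qed.

Lemma nth_fps_inv_seq f n i : (i < n)%N -> (fps_inv_seq f n)`_i = fps_inv f i.
Proof.
elim: n => // n IHn; rewrite ltnS leq_eqVlt => /orP[/eqP->//|lt_in].
by rewrite /= nth_rcons size_fps_inv_seq lt_in IHn.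
Qed.

Lemma fps_mulV f : f 0 != 0 -> fps_mul f (fps_inv f) =1 fps1.
Proof.
move=> f0 n; rewrite /fps_mul (reindex_inj rev_ord_inj) /=.
rewrite big_ord_recr /= subSS subnn subn0 {2}/fps_inv /=.
rewrite nth_rcons size_fps_inv_seq ltnn eqxx mulVKf //.
have -> : \sum_(i < n) f (n - i)%N * (fps_inv_seq f n)`_i =
          \sum_(i < n) f (n.+1 - i.+1)%N * fps_inv f (n - (n.+1 - i.+1))%N.
  apply: eq_bigr => i _.
  by rewrite subSS nth_fps_inv_seq // subKn // ltnW.
by rewrite addrC subrK.
Qed.

End FormalPowerSeries.

Section DegenerateBernoulli.
Variable K : fieldType.
Implicit Types lambda x : K.

(* (x | lambda)_n *)
Definition dfact lambda x (n : nat) : K := \prod_(i < n) (x - i%:R * lambda).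

(* (1 + lambda t)^(x / lambda), read as e^(x t) for lambda = 0; see
   degexp_binomial and degexp_exp. *)
Definition degexp lambda x : fps K := fun n => dfact lambda x n / n`!%:R.

Lemma degexp_binomial lambda x n : lambda != 0 ->
  degexp lambda x n =
    (\prod_(i < n) (x / lambda - i%:R)) / n`!%:R * lambda ^+ n.
Proof.
move=> l0; rewrite /degexp /dfact mulrAC; congr (_ / _).
rewrite -[in lambda ^+ n](card_ord n) -prodr_const -big_split /=.
by apply: eq_bigr => i _; rewrite mulrBl divfK.
Qed.

Lemma degexp_exp x n : degexp 0 x n = x ^+ n / n`!%:R.
Proof.
rewrite /degexp /dfact; under eq_bigr do rewrite mulr0 subr0.
by rewrite prodr_const card_ord.
Qed.

(* (1 + lambda t)^(1 / lambda) - 1 *)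
Definition degexpm1 lambda : fps K := fps_sub (degexp lambda 1) (fps1 K).

(* t / ((1 + lambda t)^(1 / lambda) - 1): the denominator has constant term 0
   and linear term 1, so t cancels and the quotient is a power series; see
   degexpm1_quotient. *)
Definition bernoulli_quotient lambda : fps K :=
  fps_inv (fps_divX (degexpm1 lambda)).

Lemma degexpm1_quotient lambda :
  fps_mul (degexpm1 lambda) (bernoulli_quotient lambda) =1 fpsX K.
Proof.
have E0 : degexpm1 lambda 0 = 0.
  by rewrite /degexpm1 /fps_sub /fps1 /degexp /dfact big_ord0 divr1 subrr.
have E1 : fps_divX (degexpm1 lambda) 0 != 0.
  rewrite /fps_divX /degexpm1 /fps_sub /fps1 /degexp /dfact.
  by rewrite big_ord_recl big_ord0 mul0r !subr0 mulr1 divr1 oner_eq0.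
move=> n; rewrite /fps_mul big_ord_recl /= E0 mul0r add0r.
case: n => [|n]; first by rewrite big_ord0.
rewrite -[RHS](fps_mulV E1 n); apply: eq_bigr => i _.
by rewrite /fps_divX /= /bump add1n subSS.
Qed.

(* beta_n(x | lambda) = n! [t^n] of the generating function. *)
Definition degbern_poly lambda x (n : nat) : K :=
  n`!%:R * fps_mul (bernoulli_quotient lambda) (degexp lambda x) n.

(* beta_n(lambda) *)
Definition degbern lambda (n : nat) : K := degbern_poly lambda 0 n.

End DegenerateBernoulli.

(* Main.v *)
Require Import Defs.
From mathcomp Require Import all_boot all_order all_algebra.
From mathcomp Require Import ring.
From mathcomp Require Import reals.
From mathcomp.real_closed Require Import complex.
Import GRing.Theory.
Local Open Scope ring_scope.

(* Write q = t / E with E = (1 + lambda t)^(1/lambda) - 1, and e_x for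
   (1 + lambda t)^(x/lambda). The three claims are the coefficientwise forms of
   q e_x = (q e_0) e_x, of e_x = (E/t) (q e_x), and of q (e_1 - e_0) = t. *)

Section FpsMul.
Context {K : fieldType}.
Implicit Types f g h : fps K.

Lemma eq_fps_mul {f f' g g'} :
  f =1 f' -> g =1 g' -> fps_mul f g =1 fps_mul f' g'.
Proof. by move=> ef eg n; apply: eq_bigr => i _; rewrite ef eg. Qed.

(** Coefficient [n] of a product involves only indices at most [n], so truncating beyond [n] is
    harmless. This carries the ring laws of polynomials over to series. *)
Lemma coef_mul_fps_trunc f g m n : (n < m)%N ->
  (\poly_(i < m) f i * \poly_(i < m) g i)`_n = fps_mul f g n.
Proof.
move=> lt_nm; rewrite coefM; apply: eq_bigr => i _.
by rewrite !coef_poly !(leq_ltn_trans _ lt_nm) ?leq_subr // -ltnS.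
Qed.

Lemma fps_mulC f g : fps_mul f g =1 fps_mul g f.
Proof. by move=> n; rewrite -!(coef_mul_fps_trunc _ _ n.+1) // mulrC. Qed.

Lemma fps_mulA f g h : fps_mul f (fps_mul g h) =1 fps_mul (fps_mul f g) h.
Proof.
move=> n; pose P f := \poly_(i < n.+1) f i.
(* [P g * P h] may differ from the truncation of [fps_mul g h], but only above degree [n], which
   coefficient [n] of the triple product never sees. *)
transitivity ((P f * (P g * P h))`_n).
  rewrite coefM; apply: eq_bigr => i _.
  by rewrite coef_poly ltn_ord coef_mul_fps_trunc // ltnS leq_subr.
rewrite mulrA coefM; apply: eq_bigr => i _.
by rewrite coef_mul_fps_trunc // coef_poly ltnS leq_subr.
Qed.

Lemma fps_mul1 f : fps_mul (fps1 K) f =1 f.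
Proof.
move=> n; rewrite /fps_mul big_ord_recl big1 ?mul1r ?addr0 ?subn0 // => i _.
by rewrite mul0r.
Qed.

Lemma fps_mulBr f g h n :
  fps_mul f (fps_sub g h) n = fps_mul f g n - fps_mul f h n.
Proof. by rewrite -sumrB; apply: eq_bigr => i _; rewrite mulrBr. Qed.

End FpsMul.

Section DegenerateBernoulliIdentities.
Context {K : fieldType}.
Implicit Types lambda x : K.

Lemma degexp0 lambda : degexp lambda 0 =1 fps1 K.
Proof.
case=> [|n]; first by rewrite /degexp /dfact big_ord0 divr1.
(* The factor of index 0 in the falling product is 0 - 0 * [lambda] = 0. *)
by rewrite /degexp /dfact big_ord_recl mul0r subrr !mul0r.
Qed.

Lemma degbernE lambda n : degbern lambda n = n`!%:R * bernoulli_quotient lambda n.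
Proof.
congr (_ * _); rewrite (eq_fps_mul (frefl _) (degexp0 lambda)).
by rewrite fps_mulC fps_mul1.
Qed.

(** This makes E/t invertible, so that q is a genuine inverse, and it fixes q's constant term. *)
Lemma degexpm1_divX0 lambda : fps_divX (degexpm1 lambda) 0 = 1.
Proof.
rewrite /fps_divX /degexpm1 /fps_sub /fps1 /degexp /dfact.
by rewrite big_ord_recl big_ord0 mul0r !subr0 mulr1 divr1.
Qed.

Lemma degexpm1_divX_mul lambda :
  fps_mul (fps_divX (degexpm1 lambda)) (bernoulli_quotient lambda) =1 fps1 K.
Proof. by apply: fps_mulV; rewrite degexpm1_divX0 oner_eq0. Qed.

Lemma degbern0 lambda : degbern lambda 0 = 1.
Proof.
rewrite degbernE mul1r; have := degexpm1_divX_mul lambda 0.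
by rewrite /fps_mul big_ord1 degexpm1_divX0 mul1r.
Qed.

Lemma degbern_poly1B lambda n :
  degbern_poly lambda 1 n - degbern lambda n = (1%N == n)%:R.
Proof.
rewrite -mulrBr -fps_mulBr.
have eE : fps_sub (degexp lambda 1) (degexp lambda 0) =1 degexpm1 lambda.
  by move=> m; rewrite /degexpm1 /fps_sub degexp0.
rewrite (eq_fps_mul (frefl _) eE) fps_mulC degexpm1_quotient /fpsX eq_sym.
(* The factor [n]! survives only at [n] = 1, where it equals 1. *)
by case: eqP => [<-|_]; rewrite ?mulr1 ?mulr0.
Qed.

End DegenerateBernoulliIdentities.

Section CharacteristicZero.
Context {K : numFieldType}.
Implicit Types lambda x : K.

Lemma natf_fact_neq0 n : n`!%:R != 0 :> K.
Proof. by rewrite Num.Theory.pnatr_eq0 -lt0n fact_gt0. Qed.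

(** Characteristic zero makes the factorials invertible. Binomials thus become quotients that match
    the factorials normalising the coefficients, and [field] can compare sums term by term. *)
Lemma natf_bin n l : (l <= n)%N ->
  'C(n, l)%:R = n`!%:R / (l`!%:R * (n - l)`!%:R) :> K.
Proof.
move=> le_ln; rewrite -(bin_fact le_ln) !natrM mulfK //.
by rewrite mulf_neq0 ?natf_fact_neq0.
Qed.

Lemma degbern_polyE lambda x n : degbern_poly lambda x n =
  \sum_(l < n.+1) 'C(n, l)%:R * degbern lambda l * dfact lambda x (n - l)%N.
Proof.
rewrite /degbern_poly mulr_sumr; apply: eq_bigr => l _.
rewrite degbernE natf_bin -1?ltnS // /degexp; field.
by rewrite !natf_fact_neq0.
Qed.

Lemma dfact_degbern_poly lambda x n : dfact lambda x n =
  \sum_(l < n.+1) dfact lambda 1 l.+1 / l.+1%:R * 'C(n, l)%:R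
    * degbern_poly lambda x (n - l)%N.
Proof.
have -> : dfact lambda x n = n`!%:R * degexp lambda x n.
  by rewrite mulrC divfK ?natf_fact_neq0.
(* Insert 1 = (E/t) q in front of e_x and reassociate to (E/t) (q e_x). *)
rewrite -(fps_mul1 (degexp lambda x)).
rewrite -(eq_fps_mul (degexpm1_divX_mul lambda) (frefl _)) -fps_mulA.
rewrite mulr_sumr; apply: eq_bigr => l _.
(* The shift by t reads E at index [l.+1], where the subtracted series 1 has coefficient 0. *)
rewrite /degbern_poly natf_bin -1?ltnS // /fps_divX /degexpm1 /fps_sub subr0.
(* Split (l+1)! as (l+1) l!: the factor l! goes into the binomial, and l+1 remains as the
   denominator. *)
rewrite /degexp factS natrM; field.
by rewrite !natf_fact_neq0 nat1r Num.Theory.pnatr_eq0.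
Qed.

End CharacteristicZero.

Theorem theorem2p1 (R : realType) (lambda x : R[i]) (n : nat) :
  [/\ degbern_poly lambda x n =
        \sum_(l < n.+1)
          'C(n, l)%:R * degbern lambda l * dfact lambda x (n - l)%N,
      dfact lambda x n =
        \sum_(l < n.+1)
          dfact lambda 1 l.+1 / l.+1%:R * 'C(n, l)%:R
            * degbern_poly lambda x (n - l)%N,
      degbern lambda 0 = 1
    & degbern_poly lambda 1 n - degbern lambda n = (1%N == n)%:R].
Proof.
split.
- exact: degbern_polyE.
- exact: dfact_degbern_poly.
- exact: degbern0.
- exact: degbern_poly1B.
Qed.
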